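(* Let $X$ be an Hadamard space with metric $d$ and let $T$ be a metrically nonspreading mapping of $X$ into itself. Then $\mathcal{F}(T)$ is nonempty if and only if the sequence $\{T^n x\}$ is bounded for some $x \in X$.
   Context: $\mathcal{F}(T)=\{u\in X : Tu=u\}$ denotes the set of all fixed points of $T$. A mapping $T$ of a metric space $(X,d)$ into itself is metrically nonspreading if $2d(Tx,Ty)^2 \leq d(Tx,y)^2 + d(Ty,x)^2$ for all $x,y\in X$. A metric space $X$ is uniquely geodesic if for all $x,y\in X$ there is a unique mapping $\gamma\colon[0,l]\to X$, $l=d(x,y)$, with $\gamma(0)=x$, $\gamma(l)=y$ and $d(\gamma(s),\gamma(t))=|s-t|$ for all $s,t\in[0,l]$; the point $\gamma(\alpha l)$ is denoted by $(1-\alpha)x\oplus\alpha y$ for $\alpha\in[0,1]$. A $\mathrm{CAT}(0)$ space is a uniquely geodesic metric space such that $d((1-\alpha)x\oplus\alpha y,(1-\beta)x\oplus\beta z)\leq |(1-\alpha)\bar x+\alpha\bar y-((1-\beta)\bar x+\beta\bar z)|_{\mathbb{R}^2}$ whenever $x,y,z\in X$, $\alpha,\beta\in[0,1]$ and $\bar x,\bar y,\bar z\in\mathbb{R}^2$ satisfy $d(x,y)=|\bar x-\bar y|_{\mathbb{R}^2}$, $d(y,z)=|\bar y-\bar z|_{\mathbb{R}^2}$, $d(z,x)=|\bar z-\bar x|_{\mathbb{R}^2}$, where $|\cdot|_{\mathbb{R}^2}$ is the Euclidean norm. An Hadamard space is a complete $\mathrm{CAT}(0)$ space. *)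

(* Defs.v *)
From HB Require Import structures.
From mathcomp Require Import all_boot all_order all_algebra.
From mathcomp Require Import all_classical all_reals all_analysis.

Set Implicit Arguments.
Unset Strict Implicit.
Unset Printing Implicit Defensive.

Import Order.TTheory GRing.Theory Num.Theory.

Local Open Scope classical_set_scope.
Local Open Scope ring_scope.

(* The canonical norm of 'rV[R]_2 in MathComp-Analysis is the sup norm, so the
   Euclidean norm is defined separately. *)
Definition eucl_norm (R : realType) (u : 'rV[R]_2) : R :=
  Num.sqrt (\sum_(i < 2) u ord0 i ^+ 2).

Section MetricSpaces.
Context {R : realType} {X : metricType R}.
Implicit Types (x y z : X) (a b : R).

(* A curve [0, d(x, y)] -> X is represented by a function on R of which only
   the values on [0, d(x, y)] matter. *)
Definition geodesic x y (g : R -> X) : Prop :=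
  [/\ g 0 = x,
      g (mdist x y) = y &
      {in `[0, mdist x y] &, forall s t, mdist (g s) (g t) = `|s - t|}].

(* The point (1 - a) x (+) a y; the default value x is returned when there is
   no geodesic from x to y. *)
Definition geo_comb x y a : X :=
  xget x [set p | exists2 g, geodesic x y g & p = g (a * mdist x y)].

End MetricSpaces.

Section Spaces.
Context {R : realType} (X : metricType R).

Definition uniquely_geodesic : Prop := forall x y : X,
  (exists g, geodesic x y g) /\
  (forall g h, geodesic x y g -> geodesic x y h ->
    {in `[0, mdist x y], g =1 h}).

Definition CAT0 : Prop :=
  uniquely_geodesic /\
  forall (x y z : X) (a b : R) (x' y' z' : 'rV[R]_2),
    a \in `[0, 1] -> b \in `[0, 1] ->
    mdist x y = eucl_norm (x' - y') ->
    mdist y z = eucl_norm (y' - z') ->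
    mdist z x = eucl_norm (z' - x') ->
    mdist (geo_comb x y a) (geo_comb x z b) <=
    eucl_norm (((1 - a) *: x' + a *: y') - ((1 - b) *: x' + b *: z')).

(* The library's completeType is pointed; this version also covers the empty
   space. *)
Definition metric_complete : Prop := forall u : nat -> X,
  cauchy (u @ \oo) -> exists l : X, u @ \oo --> l.

Definition hadamard : Prop := metric_complete /\ CAT0.

End Spaces.

Section Maps.
Context {R : realType} {X : metricType R}.

(* The library's bounded_set is restricted to normed modules. *)
Definition metric_bounded (A : set X) : Prop :=
  exists M : R, forall x y, A x -> A y -> mdist x y <= M.

Definition fixed_points (T : X -> X) : set X := [set u | T u = u].

Definition metrically_nonspreading (T : X -> X) : Prop := forall x y : X,
  2 * mdist (T x) (T y) ^+ 2 <= mdist (T x) y ^+ 2 + mdist (T y) x ^+ 2.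

End Maps.

Lemma geo_combE (R : realType) (X : metricType R) (x y : X) (g : R -> X)
    (a : R) :
  uniquely_geodesic X -> geodesic x y g -> a \in `[0, 1] ->
  geo_comb x y a = g (a * mdist x y).
Proof.
move=> uX gg; rewrite in_itv/= => /andP[a0 a1].
rewrite /geo_comb; case: xgetP => [p _ [h gh ->]|/(_ (g (a * mdist x y)))[]].
  apply: (uX x y).2 => //; rewrite in_itv/= mulr_ge0 ?mdist_ge0//=.
  by rewrite ler_piMl ?mdist_ge0.
by exists g.
Qed.

(* Main.v *)
Require Import Defs.
From HB Require Import structures.
From mathcomp Require Import all_boot all_order all_algebra.
From mathcomp Require Import all_classical all_reals all_analysis.
From mathcomp Require Import lra ring.

(** A bounded orbit has an asymptotic center, and a nonspreading map must fix
    that center.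

    For a bounded sequence x, let r(y) be the limsup of d(x_n, y). The CAT(0)
    inequality, applied to the midpoint m of y and z, gives the
    Bruhat-Tits (CN) inequality
      4 d(w, m)^2 + d(y, z)^2 <= 2 d(w, y)^2 + 2 d(w, z)^2,
    and taking w = x_n and passing to the limsup shows that r satisfies the
    same inequality ([asymptotic_radius_CN]). So points that almost minimize r
    are close to each other: minimizing sequences are Cauchy, and since r is
    1-Lipschitz their limit minimizes r ([exists_minimizer]). By the same
    inequality the minimizer u is unique ([asymptotic_center_unique]).

    When x_n = T^n x_0, the nonspreading inequality at x_n and y reads
      2 d(x_{n+1}, T y)^2 <= d(x_{n+1}, y)^2 + d(x_n, T y)^2.
    Its limsup is 2 r(T y)^2 <= r(y)^2 + r(T y)^2, that is, r(T y) <= r(y)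
    ([nonspreading_asymptotic_radius]). Hence T u minimizes r as well, and
    T u = u. Conversely, the orbit of a fixed point is constant. *)

Set Implicit Arguments.
Unset Strict Implicit.
Unset Printing Implicit Defensive.

Import Order.TTheory GRing.Theory Num.Theory.
Import metricType_numDomainType.

Local Open Scope classical_set_scope.
Local Open Scope ring_scope.

Definition plane_vec (R : realType) (a b : R) : 'rV[R]_2 :=
  \row_(i < 2) (if i == ord0 then a else b).

Lemma eucl_norm_sqr (R : realType) (u : 'rV[R]_2) :
  eucl_norm u ^+ 2 = u ord0 ord0 ^+ 2 + u ord0 (lift ord0 ord0) ^+ 2.
Proof.
rewrite /eucl_norm sqr_sqrtr; last by apply: sumr_ge0 => i _; exact: sqr_ge0.
by rewrite big_ord_recl big_ord1.
Qed.

Lemma eucl_norm_eq (R : realType) (u : 'rV[R]_2) (c : R) : 0 <= c ->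
  u ord0 ord0 ^+ 2 + u ord0 (lift ord0 ord0) ^+ 2 = c ^+ 2 -> c = eucl_norm u.
Proof.
move=> c0; rewrite -eucl_norm_sqr => /eqP.
by rewrite eqrXn2 ?sqrtr_ge0// => /eqP.
Qed.

(** The first vertex is put at the origin and the second on the first axis; the
    law of cosines then dictates the abscissa t of the third one, and the
    triangle inequalities say exactly that |t| <= q, which leaves room for
    its ordinate. *)
Lemma comparison_triangle (R : realType) (p q s : R) :
  0 <= p -> 0 <= q -> 0 <= s -> p <= q + s -> q <= p + s -> s <= p + q ->
  exists a b c : 'rV[R]_2,
    [/\ p = eucl_norm (a - b), s = eucl_norm (b - c) & q = eucl_norm (c - a)].
Proof.
move=> p0 q0 s0 pqs qps spq.
have [t [h [th pt]]] : exists t h : R,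
    t ^+ 2 + h ^+ 2 = q ^+ 2 /\ 2 * p * t = p ^+ 2 + q ^+ 2 - s ^+ 2.
  (* With p = 0 the law of cosines leaves t free, and q = s. *)
  have [pe0|pn0] := eqVneq p 0.
    have -> : q = s by lra.
    by exists 0, s; rewrite pe0; split; ring.
  pose t := (p ^+ 2 + q ^+ 2 - s ^+ 2) / (2 * p).
  have pt : 2 * p * t = p ^+ 2 + q ^+ 2 - s ^+ 2.
    by rewrite /t; field.
  have ppos : 0 < 2 * p by rewrite mulr_gt0// lt_neqAle eq_sym pn0.
  have tq : t <= q by rewrite -(ler_pM2l ppos) pt; nra.
  have qt : - q <= t by rewrite -(ler_pM2l ppos) pt; nra.
  exists t, (Num.sqrt (q ^+ 2 - t ^+ 2)); split => //.
  rewrite sqr_sqrtr; first by ring.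
  by nra.
exists 0, (plane_vec p 0), (plane_vec t h); split; apply: eucl_norm_eq => //;
  rewrite !mxE /=; nra.
Qed.

Section cat0.
Context {R : realType} {X : metricType R}.
Implicit Types x y z : X.

Lemma geo_comb1 x y : uniquely_geodesic X -> geo_comb x y 1 = y.
Proof.
move=> uX; have [[g gg] _] := uX x y.
rewrite (geo_combE uX gg) ?mul1r; first by case: gg.
by rewrite in_itv /= lexx ler01.
Qed.

(** Comparison of the midpoint of x and y with the endpoint z of the side from x
    to z (parameters 1/2 and 1) reduces this to the parallelogram law in the
    Euclidean plane. *)
Lemma CN_inequality x y z : CAT0 X ->
  4 * mdist z (geo_comb x y 2^-1) ^+ 2 + mdist x y ^+ 2 <=
  2 * mdist z x ^+ 2 + 2 * mdist z y ^+ 2.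
Proof.
move=> [uX cat].
have [a [b [c [xy yz zx]]]] := @comparison_triangle R
  (mdist x y) (mdist z x) (mdist y z) (mdist_ge0 _ _) (mdist_ge0 _ _)
  (mdist_ge0 _ _)
  ltac:(by rewrite (metric_sym z) (metric_sym y z) metric_triangle)
  ltac:(by rewrite (metric_sym z) metric_triangle)
  ltac:(by rewrite (metric_sym x) (metric_sym z) metric_triangle).
have := cat x y z 2^-1 1 a b c.
rewrite !in_itv /= lexx ler01 invr_ge0 ler0n.
have h1 : 2^-1 <= 1 :> R by lra.
rewrite h1 => /(_ isT isT xy yz zx); rewrite geo_comb1// metric_sym => dm.
have {dm} : mdist z (geo_comb x y 2^-1) ^+ 2 <=
    eucl_norm ((1 - 2^-1) *: a + 2^-1 *: b - ((1 - 1) *: a + 1 *: c)) ^+ 2.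
  by rewrite lerXn2r// nnegrE ?mdist_ge0// sqrtr_ge0.
rewrite (metric_sym z y) xy yz zx !eucl_norm_sqr !mxE.
by lra.
Qed.

End cat0.

(** The last hypothesis is a uniform convexity of f ^+ 2: it bounds the distance
    between two points by the excess of their values over the infimum, so
    that every minimizing sequence is Cauchy. *)
Lemma exists_minimizer (R : realType) (X : metricType R) (f : X -> R) :
  metric_complete X -> [set: X] !=set0 -> (forall y, 0 <= f y) ->
  (forall y z, f z <= f y + mdist y z) ->
  (forall y z, exists m,
    4 * f m ^+ 2 + mdist y z ^+ 2 <= 2 * f y ^+ 2 + 2 * f z ^+ 2) ->
  exists u, forall y, f u <= f y.
Proof.
move=> cX [x0 _] f0 flip fcvx.
pose s := inf (range f).
have lb : has_lbound (range f) by exists 0 => _ [y _ <-].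
have sf y : s <= f y by apply: ge_inf => //; exists y.
have s0 : 0 <= s.
  by apply: lb_le_inf => [|_ [y _ <-]]; [exists (f x0), x0|].
have minseq k : exists y, f y < s + k.+1%:R^-1.
  have hi : has_inf (range f) by split => //; exists (f x0), x0.
  have k0 : 0 < k.+1%:R^-1 :> R by rewrite invr_gt0.
  have [_ [y _ <-] fy] := inf_adherent k0 hi.
  by exists y.
have [u_ fu_] := choice minseq.
have fu_lt e : 0 < e -> \forall k \near \oo, f (u_ k) < s + e.
  move=> e0; near=> k; apply: (lt_trans (fu_ k)); rewrite ltrD2l.
  by near: k; exact: near_infty_natSinv_lt (PosNum e0).
(* The value at m is at least s, so d(y, z)^2 <= 4 ((s + e)^2 - s^2). *)
have close y z e : f y < s + e -> f z < s + e ->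
    mdist y z ^+ 2 <= 4 * e * (2 * s + e).
  move=> fy fz; have [m] := fcvx y z.
  have := sf m; have := f0 y; have := f0 z; nra.
have /cX[u cu] : cauchy (u_ @ \oo).
  apply/cauchy_ballP => e e0.
  (* Chosen so that 4 d (2 s + d) <= 4 d (2 s + 1) <= e^2 / 2. *)
  pose d := Num.min 1 (e ^+ 2 / (8 * (2 * s + 1))).
  have sp : 0 < 2 * s + 1 by lra.
  have d0 : 0 < d by rewrite /d lt_min ltr01 divr_gt0 ?mulr_gt0 ?exprn_gt0.
  have d1 : d <= 1 by rewrite /d ge_min lexx.
  have de : 8 * d * (2 * s + 1) <= e ^+ 2.
    have : d <= e ^+ 2 / (8 * (2 * s + 1)) by rewrite /d ge_min lexx orbT.
    by rewrite ler_pdivlMr ?mulr_gt0//; lra.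
  rewrite near_map2; near=> p q; rewrite ballEmdist /=.
  rewrite -ltr_sqr ?nnegrE ?mdist_ge0 ?(ltW e0)//.
  have fp : f (u_ p) < s + d by near: p; exact: fu_lt.
  have fq : f (u_ q) < s + d by near: q; exact: fu_lt.
  have := close _ _ _ fp fq; have := exprn_gt0 2 e0; nra.
exists u => y; apply: le_trans (sf y).
apply/ler_addgt0Pr => e e0.
have e20 : 0 < e / 2 by lra.
have [k [fk dk]] : exists k, f (u_ k) < s + e / 2 /\ mdist u (u_ k) < e / 2.
  apply: (@filter_ex _ (nbhs \oo)); near=> k; split; near: k.
  - exact: fu_lt.
  - exact: (cvgr_dist_lt cu e20).
have := flip (u_ k) u; rewrite metric_sym; lra.
Unshelve. all: by end_near. Qed.

Section asymptotic_radius.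
Context {R : realType} {X : metricType R}.
Implicit Types (x : nat -> X) (y z : X).

(** The limsup of d(x_n, y), as the infimum of the eventual upper bounds; it is
    meaningful for bounded x only, the infimum of the empty set being 0. *)
Definition asymptotic_radius x y : R :=
  inf [set c | \forall n \near \oo, mdist (x n) y <= c].

Lemma asymptotic_radius_lbound x y :
  lbound [set c | \forall n \near \oo, mdist (x n) y <= c] 0.
Proof.
by move=> c /= xc; have [n] := filter_ex xc; apply: le_trans; exact: mdist_ge0.
Qed.

Lemma asymptotic_radius_le x y c :
  (\forall n \near \oo, mdist (x n) y <= c) -> asymptotic_radius x y <= c.
Proof. by apply: ge_inf; exists 0; exact: asymptotic_radius_lbound. Qed.

Lemma bounded_range_near x y : metric_bounded (range x) ->
  exists c, \forall n \near \oo, mdist (x n) y <= c.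
Proof.
move=> [M xM]; exists (M + mdist (x 0%N) y); near=> n.
by rewrite (le_trans (metric_triangle _ (x 0%N) _))// lerD2r xM//; exists n + exists 0%N.
Unshelve. all: by end_near. Qed.

Lemma asymptotic_radius_ge0 x y :
  metric_bounded (range x) -> 0 <= asymptotic_radius x y.
Proof.
move=> bx; apply: lb_le_inf; last exact: asymptotic_radius_lbound.
exact: bounded_range_near.
Qed.

Lemma asymptotic_radius_lt x y c : metric_bounded (range x) ->
  asymptotic_radius x y < c -> \forall n \near \oo, mdist (x n) y <= c.
Proof.
move=> bx /inf_lt[|b /= xb bc]; first exact: bounded_range_near.
by apply: filterS xb => n /le_trans; apply; exact: ltW.
Qed.

Lemma asymptotic_radius_lipschitz x y z : metric_bounded (range x) ->
  asymptotic_radius x z <= asymptotic_radius x y + mdist y z.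
Proof.
move=> bx; apply/ler_addgt0Pr => e e0; apply: asymptotic_radius_le.
have /(asymptotic_radius_lt bx) :
  asymptotic_radius x y < asymptotic_radius x y + e by rewrite ltrDl.
apply: filterS => n xn; rewrite (le_trans (metric_triangle _ y _))//.
by rewrite addrAC lerD2r.
Qed.

(** The CN and nonspreading inequalities involve squared distances; this lemma
    and the next one identify r(y)^2 with the limsup of d(x_n, y)^2, so that
    such inequalities pass to the limit. *)
Lemma asymptotic_radius_sqr_le x y c : metric_bounded (range x) ->
  (\forall n \near \oo, mdist (x n) y ^+ 2 <= c) ->
  asymptotic_radius x y ^+ 2 <= c.
Proof.
move=> bx xc.
have c0 : 0 <= c by have [n] := filter_ex xc; apply: le_trans; exact: sqr_ge0.
rewrite -(sqr_sqrtr c0) lerXn2r ?nnegrE ?asymptotic_radius_ge0 ?sqrtr_ge0//.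
apply: asymptotic_radius_le; apply: filterS xc => n xn.
by rewrite -(ler_sqr (mdist_ge0 _ _)) ?nnegrE ?sqrtr_ge0 ?mdist_ge0 ?sqr_sqrtr.
Qed.

Lemma asymptotic_radius_sqr_lt x y c : metric_bounded (range x) ->
  asymptotic_radius x y ^+ 2 < c -> \forall n \near \oo, mdist (x n) y ^+ 2 <= c.
Proof.
move=> bx xc.
have c0 : 0 <= c by rewrite ltW// (le_lt_trans _ xc)// sqr_ge0.
have /(asymptotic_radius_lt bx) : asymptotic_radius x y < Num.sqrt c.
  by rewrite -ltr_sqr ?nnegrE ?asymptotic_radius_ge0 ?sqrtr_ge0 ?sqr_sqrtr.
apply: filterS => n xn.
by rewrite -(sqr_sqrtr c0) lerXn2r ?nnegrE ?mdist_ge0 ?sqrtr_ge0.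
Qed.

(** The CN inequality at the points x_n, in the limsup. *)
Lemma asymptotic_radius_CN x y z : CAT0 X -> metric_bounded (range x) ->
  4 * asymptotic_radius x (geo_comb y z 2^-1) ^+ 2 + mdist y z ^+ 2 <=
  2 * asymptotic_radius x y ^+ 2 + 2 * asymptotic_radius x z ^+ 2.
Proof.
move=> cat bx; apply/ler_addgt0Pr => e e0.
set m := geo_comb y z _.
set ry := asymptotic_radius x y; set rz := asymptotic_radius x z.
suff : asymptotic_radius x m ^+ 2 <=
    (2 * ry ^+ 2 + 2 * rz ^+ 2 + e - mdist y z ^+ 2) / 4 by lra.
apply: asymptotic_radius_sqr_le => //.
have : \forall n \near \oo, mdist (x n) y ^+ 2 <= ry ^+ 2 + e / 4.
  by apply: asymptotic_radius_sqr_lt => //; lra.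
have : \forall n \near \oo, mdist (x n) z ^+ 2 <= rz ^+ 2 + e / 4.
  by apply: asymptotic_radius_sqr_lt => //; lra.
apply: filterS2 => n; have := CN_inequality y z (x n) cat; rewrite -/m; lra.
Qed.

Lemma exists_asymptotic_center x : hadamard X -> metric_bounded (range x) ->
  exists u, forall y, asymptotic_radius x u <= asymptotic_radius x y.
Proof.
move=> [cX cat] bx; apply: exists_minimizer => //.
- by exists (x 0%N).
- by move=> y; exact: asymptotic_radius_ge0.
- by move=> y z; exact: asymptotic_radius_lipschitz.
- by move=> y z; exists (geo_comb y z 2^-1); exact: asymptotic_radius_CN.
Qed.

(** If u minimizes r and v does too, the midpoint of u and v has radius at least
    r(u), and CN leaves no room for a positive distance between them. *)
Lemma asymptotic_center_unique x u v : CAT0 X -> metric_bounded (range x) ->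
  (forall y, asymptotic_radius x u <= asymptotic_radius x y) ->
  asymptotic_radius x v <= asymptotic_radius x u -> v = u.
Proof.
move=> cat bx umin vu; apply: mdist_positivity; apply/eqP.
rewrite -sqrf_eq0 eq_le sqr_ge0 andbT.
have := asymptotic_radius_CN v u cat bx; have := umin (geo_comb v u 2^-1).
have := asymptotic_radius_ge0 u bx; have := asymptotic_radius_ge0 v bx.
nra.
Qed.

(** The nonspreading inequality at x_n and y mixes the indices n and n + 1, which
    the limsup does not distinguish; it becomes
    2 r(T y)^2 <= r(y)^2 + r(T y)^2. *)
Lemma nonspreading_asymptotic_radius (T : X -> X) x y :
  metrically_nonspreading T -> (forall n, x n.+1 = T (x n)) ->
  metric_bounded (range x) ->
  asymptotic_radius x (T y) <= asymptotic_radius x y.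
Proof.
move=> nT xS bx.
rewrite -ler_sqr ?nnegrE ?asymptotic_radius_ge0//.
apply/ler_addgt0Pr => e e0.
set ry := asymptotic_radius x y; set rT := asymptotic_radius x (T y).
suff : rT ^+ 2 <= (ry ^+ 2 + rT ^+ 2 + e) / 2 by lra.
apply: asymptotic_radius_sqr_le => //; apply: near_inftyS.
have yS : \forall n \near \oo, mdist (x n.+1) y ^+ 2 <= ry ^+ 2 + e / 2.
  have [|N _ xN] := @asymptotic_radius_sqr_lt x y (ry ^+ 2 + e / 2) bx.
    by rewrite ltrDl; lra.
  by exists N => // n /= Nn; apply: xN; exact: leqW.
have : \forall n \near \oo, mdist (x n) (T y) ^+ 2 <= rT ^+ 2 + e / 2.
  by apply: asymptotic_radius_sqr_lt => //; lra.
apply: filterS2 yS => n; have := nT (x n) y.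
by rewrite -xS (metric_sym (T y)); lra.
Qed.

End asymptotic_radius.

Theorem theorem4p2 (R : realType) (X : metricType R) (T : X -> X) :
  hadamard X -> metrically_nonspreading T ->
  (fixed_points T !=set0 <->
   exists x : X, metric_bounded (range (fun n : nat => iter n T x))).
Proof.
move=> hX nT; split=> [[u Tu]|[x bx]].
  exists u, 0 => _ _ [m _ <-] [n _ <-].
  have iterTu k : iter k T u = u by elim: k => //= k ->.
  by rewrite !iterTu mdistxx.
have [u umin] := exists_asymptotic_center hX bx.
exists u; apply: (asymptotic_center_unique hX.2 bx umin).
exact: nonspreading_asymptotic_radius.
Qed.
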